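(* Let $\frac{r}{s}$ and $\frac{r'}{s}$ be irreducible fractions with the same denominator $s>0$. If $rr'\equiv 1 \pmod{s}$, then $\mathcal{S}^\flat_{\frac{r}{s}}(q)=\mathcal{S}^\flat_{\frac{r'}{s}}(q)$. If $rr'\equiv -1 \pmod{s}$, then $\mathcal{S}^\flat_{\frac{r}{s}}(q)=\mathcal{S}^\flat_{\frac{r'}{s}}(q)^\vee$.
   Context: Irreducible fractions $\frac rs\in\mathbb{Q}$ are written with $s>0$. Each $\frac rs\in\mathbb Q$ has an even-length regular continued fraction $\frac rs=[a_1,\ldots,a_{2m}]=a_1+\cfrac{1}{a_2+\cfrac{1}{\ddots+\cfrac1{a_{2m}}}}$, unique under the conventions: if $\frac rs>0$, then $a_1\ge 0$ and $a_i\ge 1$ for $i\ge2$; if $\frac rs<0$, then $a_1\le 0$ and $a_i\le -1$ for $i\ge 2$; and $\frac01=[-1,1]$. Let $q$ be a formal parameter, $R_q=\begin{pmatrix} q&1\\0&1\end{pmatrix}$, $L_q=\begin{pmatrix}1&0\\1&q^{-1}\end{pmatrix}$, and $M_q(a_1,\ldots,a_{2m})=R_q^{a_1}L_q^{a_2}\cdots R_q^{a_{2m-1}}L_q^{a_{2m}}\in \mathrm{GL}(2,\mathbb Z[q^{\pm1}])$. Matrices act by fractional linear transformations. The left $q$-deformed rational number of $\frac rs=[a_1,\ldots,a_{2m}]$ is $\left[\frac rs\right]^\flat_q=M_q(a_1,\ldots,a_{2m})\left(\frac1{1-q}\right)$. It is written as $\left[\frac rs\right]^\flat_q=\frac{\mathcal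 R^\flat_{r/s}(q)}{\mathcal S^\flat_{r/s}(q)}$ with $\mathcal R^\flat_{r/s}(q)\in\mathbb Z[q^{\pm1}]$ and $\mathcal S^\flat_{r/s}(q)\in\mathbb Z[q]$ obtained by multiplying both entries of the vector $M_q(a_1,\ldots,a_{2m})\begin{pmatrix}1\\1-q\end{pmatrix}$ by a common $\pm q^n$ so that $\mathcal S^\flat_{r/s}(0)=1$. One has $\mathcal R^\flat_{r/s}(1)=r$ and $\mathcal S^\flat_{r/s}(1)=s$. For $f(q)\in\mathbb Z[q]$, $f(q)^\vee:=q^{\deg f}f(q^{-1})$ denotes the reciprocal polynomial. *)

(* Defs.v *)
From HB Require Import structures.
From mathcomp Require Import all_boot all_order all_algebra.
From mathcomp Require Import ring lra zify.

Set Implicit Arguments.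
Unset Strict Implicit.
Unset Printing Implicit Defensive.

Import Order.TTheory GRing.Theory Num.Theory.
Local Open Scope ring_scope.

(* [a_1, ..., a_n] = a_1 + 1 / [a_2, ..., a_n]; thanks to 0^-1 = 0, the base
   value 0 makes the one-term fraction [a_1] evaluate to a_1. *)
Fixpoint cfval (a : seq int) : rat :=
  if a is b :: t then b%:~R + (cfval t)^-1 else 0.

Definition is_even_cf (x : rat) (a : seq int) : bool :=
  [&& ~~ odd (size a), cfval a == x
    & if x == 0 then a == [:: -1; 1]
      else if 0 < x then (0 <= head 0 a) && all (fun b : int => 1 <= b) (behead a)
      else (head 0 a <= 0) && all (fun b : int => b <= -1) (behead a)].

Lemma cf_gt1 (n m : nat) (b : bool) : (0 < m < n)%N ->
  exists a : seq int, [&& odd (size a) == b, cfval a == n%:R / m%:R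
                        & all (fun c : int => 1 <= c) a].
Proof.
elim/ltn_ind: m n b => m IH n b /andP[m0 mn].
have m0' : m%:R != 0 :> rat by rewrite pnatr_eq0; lia.
have q1 : (0 < n %/ m)%N by rewrite divn_gt0 // ltnW.
have En : n%:R / m%:R = (n %/ m)%:R + (n %% m)%:R / m%:R :> rat.
  by rewrite {1}(divn_eq n m) natrD natrM mulrDl mulfK.
have [r0|r0] := posnP (n %% m).
  have q2 : (1 < n %/ m)%N.
    by move: mn; rewrite {1}(divn_eq n m) r0; nia.
  rewrite r0 mul0r addr0 in En; rewrite En.
  case: b.
    exists [:: (n %/ m)%:Z]; rewrite /= invr0 addr0 eqxx /= andbT; lia.
  exists [:: (n %/ m)%:Z - 1; 1]; rewrite /= invr0 addr0 invr1.
  apply/andP; split; last by lia.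
  by rewrite rmorphB /= subrK.
have [|a /and3P[sa va aa]] := IH _ (ltn_pmod n m0) m (~~ b).
  by rewrite r0 ltn_pmod.
exists ((n %/ m)%:Z :: a) => /=; rewrite aa (eqP va) invf_div En eqxx (eqP sa) negbK eqxx /=.
by rewrite andbT; lia.
Qed.

Lemma cfval_opp (a : seq int) : cfval [seq - b | b <- a] = - cfval a.
Proof. by elim: a => [|b a IH] /=; rewrite ?oppr0 // IH invrN rmorphN opprD. Qed.

Lemma even_cf_pos (x : rat) : 0 < x -> exists a, is_even_cf x a.
Proof.
move=> x0; have [n [m [n0 m0 ->]]] :
    exists n m : nat, [/\ (0 < n)%N, (0 < m)%N & x = n%:R / m%:R].
  exists `|numq x|%N, `|denq x|%N; split; rewrite ?absz_gt0 ?numq_eq0 ?gt_eqF //.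
  by rewrite -[LHS]divq_num_den !natr_absz !gtr0_norm ?numq_gt0 ?denq_gt0.
have pos : 0 < n%:R / m%:R :> rat by rewrite divr_gt0 ?ltr0n.
rewrite /is_even_cf pos (gt_eqF pos).
case: (ltngtP m n) => [mn|nm|emn].
- have [|a /and3P[/eqP sa va aa]] := @cf_gt1 n m false; first by rewrite m0.
  exists a; rewrite sa va /=; case: a aa {sa va} => //= b a /andP[b1 ->].
  by rewrite andbT (le_trans _ b1).
- have [|a /and3P[/eqP sa /eqP va aa]] := @cf_gt1 m n true; first by rewrite n0.
  by exists (0 :: a); rewrite /= sa va add0r invf_div eqxx aa.
- exists [:: 0; 1]; rewrite emn divff ?pnatr_eq0; [by [] | lia].
Qed.

Lemma even_cf_exists (x : rat) : exists a, is_even_cf x a.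
Proof.
case: (ltgtP x 0) => [x0|/even_cf_pos //|->]; last by exists [:: -1; 1].
have [|a] := @even_cf_pos (- x); first by rewrite oppr_gt0.
rewrite /is_even_cf oppr_eq0 oppr_gt0 x0 (lt_eqF x0) => /and3P[sa /eqP va /andP[h t]].
exists [seq - b | b <- a]; rewrite size_map sa cfval_opp va opprK eqxx.
rewrite ltNge ltW //=; case: a h t {sa va} => //= b a b0 aa.
rewrite oppr_le0 b0 all_map; apply: sub_all aa => c /= ; lia.
Qed.

(* Such a sequence is unique, so the canonical choice xchoose is *the* expansion. *)
Definition even_cf (x : rat) : seq int := xchoose (even_cf_exists x).

Lemma even_cfP (x : rat) : is_even_cf x (even_cf x).
Proof. exact: (xchooseP (even_cf_exists x)). Qed.

(* Z[q, q^-1] is viewed inside the fraction field of Z[q]. *)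
Notation Zq := {fraction {poly int}}.

Definition q : Zq := FracField.tofrac 'X.

Definition mx2 (a b c d : Zq) : 'M[Zq]_2 :=
  \matrix_(i, j) if i == 0 then (if j == 0 then a else b)
                 else (if j == 0 then c else d).

Definition Rq : 'M[Zq]_2 := mx2 q 1 0 1.
Definition Lq : 'M[Zq]_2 := mx2 1 0 1 q^-1.

Fixpoint Mq (a : seq int) : 'M[Zq]_2 :=
  if a is b :: c :: t then Rq ^ b * Lq ^ c * Mq t else 1.

Definition cv2 (a b : Zq) : 'cV[Zq]_2 := \col_i if i == 0 then a else b.

Definition moebius (M : 'M[Zq]_2) (z : Zq) : Zq :=
  (M 0 0 * z + M 0 1) / (M 1 0 * z + M 1 1).

Definition left_q_rational (x : rat) : Zq :=
  moebius (Mq (even_cf x)) (1 / (1 - q)).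

Definition left_vec (x : rat) : 'cV[Zq]_2 := Mq (even_cf x) *m cv2 1 (1 - q).

(* t = (e, n, S): multiplication by (-1)^e q^n turns the lower entry of w into
   a polynomial S with S(0) = 1. *)
Definition normalizes (w : 'cV[Zq]_2) (t : bool * int * {poly int}) : bool :=
  ((-1) ^+ t.1.1 * q ^ t.1.2 * w 1 0 == FracField.tofrac t.2) && (t.2.[0] == 1).

Lemma mulKunit (R : comUnitRingType) (A : 'M[R]_2) (w : 'cV[R]_2) :
  A \is a GRing.unit -> A^-1 *m (A *m w) = w.
Proof. by move=> uA; rewrite mulmxA (mulVr uA : A^-1 *m A = 1%:M) mul1mx. Qed.

Section FieldIdentities.
Variables (K : fieldType) (z k u v p : K).
Hypothesis z0 : z != 0.

Fact pos_R1 : z * (k * u) + 1 * (k * v) = k * (z * u + v).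
Proof. by ring. Qed.

Fact pos_L1 : 1 * (k * u) + 0 * (k * v) = k / z * (z * u).
Proof. by field. Qed.

Fact pos_L2 : 1 * (k * u) + z^-1 * (k * v) = k / z * (z * u + v).
Proof. by field. Qed.

Fact neg_R1 :
  z * (k / z * (u + z * p * v)) + 1 * - (k / z * z * (z * p) * v) = k * u.
Proof. by field. Qed.

Fact neg_R2 c : 0 * c + 1 * - (k / z * z * (z * p) * v) = - (k * z * p * v).
Proof. by field. Qed.

Fact neg_L2 :
  1 * (k * u) + z^-1 * - (k * z * 1 * (u + z * p * v)) = - (k * z * p * v).
Proof. by field. Qed.

Fact neg_L0 : 1 * 1 + z^-1 * - (z * z) = 1 - z.
Proof. by field. Qed.

Fact zero_R1 : z * (z^-1 * (1 - z^-1)) + 1 * z^-1 = 1.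
Proof. by field. Qed.

Fact zero_L2 : 0 * (z^-1 * (1 - z^-1)) + 1 * z^-1 = 1 + z^-1 * (1 - z).
Proof. by field. Qed.

Fact moebius_scale a b c d : 1 - z != 0 ->
  (a / (1 - z) + b) / (c / (1 - z) + d)
    = (a + b * (1 - z)) / (c + d * (1 - z)).
Proof.
move=> z1; rewrite -[LHS]mulr1 -(divff z1) mulf_div.
by congr (_ / _); field.
Qed.

End FieldIdentities.

Lemma q_neq0 : q != 0.
Proof. by rewrite tofrac_eq0 polyX_eq0. Qed.

Lemma mul_mx2 a b c d u v :
  mx2 a b c d *m cv2 u v = cv2 (a * u + b * v) (c * u + d * v).
Proof. by apply/matrixP=> i j; rewrite !mxE !big_ord_recl big_ord0 !mxE /=; case: (i == 0); rewrite addr0. Qed.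

Lemma mx2_unit a b c d : a * d - b * c != 0 -> mx2 a b c d \is a GRing.unit.
Proof.
move=> h; rewrite [_ \is a _]unitmxE unitfE (expand_det_row _ 0) !big_ord_recl big_ord0.
by rewrite /cofactor !det_mx11 !mxE /= expr0 expr1 mul1r mulN1r mulrN addr0.
Qed.

Lemma Rq_unit : Rq \is a GRing.unit.
Proof. by apply: mx2_unit; rewrite mulr1 mulr0 subr0 q_neq0. Qed.

Lemma Lq_unit : Lq \is a GRing.unit.
Proof. by apply: mx2_unit; rewrite mul1r mul0r subr0 invr_neq0 ?q_neq0. Qed.

Local Notation "x %:F" := (FracField.tofrac x).

Section Invariants.
Variable P : 'cV[Zq]_2 -> Prop.

Lemma iter_ge0 (A : 'M[Zq]_2) (n : int) w :
  (forall w, P w -> P (A *m w)) -> 0 <= n -> P w -> P (A ^ n *m w).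
Proof.
move=> PA; case: n => // n _ Pw; elim: n => [|n IH]; first by rewrite expr0z mul1mx.
by rewrite -exprnP exprS -mulmxA; apply: PA; rewrite exprnP.
Qed.

Lemma iter_le0 (A : 'M[Zq]_2) (n : int) w : A \is a GRing.unit ->
  (forall w, P w -> exists2 w', P w' & A *m w' = w) -> n <= 0 ->
  P w -> P (A ^ n *m w).
Proof.
move=> uA PA n0; rewrite -[n]opprK -exprz_inv; apply: iter_ge0; last by lia.
by move=> {}w /PA[w' Pw' <-]; rewrite (mulKunit _ uA).
Qed.
End Invariants.

(* pos_inv and neg_inv are the shapes of M_q(a) (1, 1 - q)^T for expansions
   with nonnegative, resp. nonpositive, entries; they yield the normalization. *)
Definition pos_inv (w : 'cV[Zq]_2) : Prop := exists (k : int) (U V : {poly int}),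
  w = cv2 (q ^ k * U%:F) (q ^ k * V%:F) /\ V.[0] = 1.

Lemma pos_Rq w : pos_inv w -> pos_inv (Rq *m w).
Proof.
move=> [k [U [V [-> V0]]]]; exists k, ('X * U + V), V; split=> //.
by rewrite mul_mx2 tofracD tofracM -/q pos_R1 mul0r mul1r add0r.
Qed.

Lemma pos_Lq w : pos_inv w -> pos_inv (Lq *m w).
Proof.
move=> [k [U [V [-> V0]]]]; exists (k - 1), ('X * U), ('X * U + V).
split; last by rewrite !hornerE ?mul0r ?add0r V0.
rewrite mul_mx2 tofracD !tofracM -/q expfzDr ?q_neq0 // exprN1.
by rewrite (pos_L1 _ _ _ q_neq0) (pos_L2 _ _ _ q_neq0).
Qed.

Lemma pos_inv0 : pos_inv (cv2 1 (1 - q)).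
Proof.
exists 0, 1, (1 - 'X); split; last by rewrite !hornerE.
by rewrite expr0z tofracB tofrac1 -/q !mul1r.
Qed.

Definition neg_inv (w : 'cV[Zq]_2) : Prop := exists (k : int) (j : nat) (U W : {poly int}),
  [/\ w = cv2 (q ^ k * U%:F) (- (q ^ k * q * q ^+ j * W%:F)), U.[0] = 1 & W.[0] = 1].

Lemma neg_Rq w : neg_inv w -> exists2 w', neg_inv w' & Rq *m w' = w.
Proof.
move=> [k [j [U [W [-> U0 W0]]]]].
exists (cv2 (q ^ (k - 1) * (U + 'X ^+ j.+1 * W)%:F)
            (- (q ^ (k - 1) * q * q ^+ j.+1 * W%:F))).
  by exists (k - 1), j.+1, (U + 'X ^+ j.+1 * W), W; split; rewrite // !hornerE U0 ?expr0n ?mul0r ?addr0.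
rewrite mul_mx2 tofracD (tofracM ('X ^+ _)) tofracXn -/q expfzDr ?q_neq0 // exprN1 exprS.
by rewrite (neg_R1 _ _ _ _ q_neq0) (neg_R2 _ _ _ q_neq0).
Qed.

Lemma neg_Lq w : neg_inv w -> exists2 w', neg_inv w' & Lq *m w' = w.
Proof.
move=> [k [j [U [W [-> U0 W0]]]]].
exists (cv2 (q ^ k * U%:F) (- (q ^ k * q * q ^+ 0 * (U + 'X ^+ j.+1 * W)%:F))).
  by exists k, 0%N, U, (U + 'X ^+ j.+1 * W); split; rewrite // !hornerE U0 ?expr0n ?mul0r ?addr0.
rewrite mul_mx2 tofracD (tofracM ('X ^+ _)) tofracXn -/q exprS expr0.
by rewrite (neg_L2 _ _ _ _ q_neq0) mul0r addr0 mul1r.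
Qed.

Lemma neg_inv1 (n : int) : n <= -1 -> neg_inv (Lq ^ n *m cv2 1 (1 - q)).
Proof.
move=> n1; have -> : n = (n + 1) - 1 by ring.
rewrite (exprzDr Lq_unit) exprN1 -mulmxA; apply: iter_le0; rewrite ?Lq_unit //.
- exact: neg_Lq.
- lia.
suff -> : Lq^-1 *m cv2 1 (1 - q) = cv2 1 (- (q * q)).
  exists 0, 1%N, 1, 1; split; [|by rewrite hornerE|by rewrite hornerE].
  by rewrite tofrac1 expr0z !mulr1 !mul1r expr1.
have -> : cv2 1 (1 - q) = Lq *m cv2 1 (- (q * q)).
  by rewrite mul_mx2 (neg_L0 q_neq0) mul1r mul0r addr0.
by rewrite (mulKunit _ Lq_unit).
Qed.

Lemma Mq_pos (a : seq int) : ~~ odd (size a) -> 0 <= head 0 a ->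
  all (fun b : int => 1 <= b) (behead a) -> pos_inv (Mq a *m cv2 1 (1 - q)).
Proof.
have [n] := ubnP (size a); elim: n a => // n IH [|b [|c a]] //=.
  by move=> *; rewrite mul1mx; exact: pos_inv0.
rewrite negbK !ltnS => sz ev b0 /andP[c1 aa]; rewrite -!mulmxA.
apply: (iter_ge0 pos_Rq) => //; apply: (iter_ge0 pos_Lq); first by lia.
case: a sz ev aa => [|d a] sz ev aa; first by apply: IH => //=; move: sz => /=; lia.
by move/andP: aa => [d1 aa]; apply: IH => //=; move: sz ev => /=; lia.
Qed.

Lemma Mq_neg (a : seq int) : ~~ odd (size a) -> (0 < size a)%N -> head 0 a <= 0 ->
  all (fun b : int => b <= -1) (behead a) -> neg_inv (Mq a *m cv2 1 (1 - q)).
Proof.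
have [n] := ubnP (size a); elim: n a => // n IH [|b [|c a]] //=.
rewrite negbK !ltnS => sz ev _ b0 /andP[c1 aa]; rewrite -!mulmxA.
apply: (iter_le0 Rq_unit neg_Rq) => //.
case: a sz ev aa => [|d a] sz ev aa; first by rewrite /= mul1mx; exact: neg_inv1.
apply: (iter_le0 Lq_unit neg_Lq); first by lia.
by move/andP: aa => [d1 aa]; apply: IH => //=; move: sz ev => /=; lia.
Qed.

Lemma left_norm_exists (x : rat) : exists t, normalizes (left_vec x) t.
Proof.
have qn0 k : q ^ k != 0 by rewrite expfz_neq0 ?q_neq0.
have normP (w : 'cV[Zq]_2) (k : int) (V : {poly int}) :
    w 1 0 = q ^ k * V%:F -> V.[0] = 1 -> exists t, normalizes w t.
  move=> wE V0; exists (false, - k, V); rewrite /normalizes /= V0 eqxx andbT wE.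
  by rewrite expr0 mul1r mulrA -expfzDr ?q_neq0 // addNr expr0z mul1r.
rewrite /left_vec; have := even_cfP x; move: (even_cf x) => a /and3P[sa /eqP va].
case: eqP => [_ /eqP->|/eqP x0]; last case: ltP => _ /andP[ha ta].
- apply: (normP _ (-1) 1); last by rewrite hornerE.
  rewrite /= mulr1 -mulmxA exprN1 expr1z mul_mx2 tofrac1 !mulr1.
  rewrite -(zero_L2 q_neq0) mul0r addr0 -[X in cv2 X _](zero_R1 q_neq0).
  by rewrite -mul_mx2 (mulKunit _ Rq_unit) mxE.
- have [k [U [V [-> V0]]]] := Mq_pos sa ha ta.
  by apply: (normP _ k V); rewrite // mxE.
have [|k [j [U [W [-> U0 W0]]]]] := Mq_neg sa _ ha ta.
  by case: a va {sa ha ta} => //= E; rewrite -E eqxx in x0.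
exists (true, - (k + 1 + j%:Z), W); rewrite /normalizes /= W0 eqxx andbT !mxE /=.
rewrite -invr_expz !expfzDr ?q_neq0 // expr1z -exprnP expr1.
rewrite mulN1r mulrNN.
rewrite mulKf; first exact: eqxx.
exact: (mulf_neq0 (mulf_neq0 (qn0 k) q_neq0) (expf_neq0 j q_neq0)).
Qed.

(* left_vec x determines the triple, since S(0) = 1 fixes both n and e. *)
Definition left_norm (x : rat) : bool * int * {poly int} :=
  xchoose (left_norm_exists x).

Lemma left_normP (x : rat) : normalizes (left_vec x) (left_norm x).
Proof. exact: (xchooseP (left_norm_exists x)). Qed.

Definition Sflat (x : rat) : {poly int} := (left_norm x).2.

Definition Rflat (x : rat) : Zq :=
  (-1) ^+ (left_norm x).1.1 * q ^ (left_norm x).1.2 * left_vec x 0 0.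

Lemma left_q_rationalE (x : rat) : left_q_rational x = Rflat x / (Sflat x)%:F.
Proof.
have /andP[/eqP <- _] := left_normP x.
rewrite /Rflat /left_q_rational /moebius /left_vec -mulf_div divff ?mul1r; last first.
  by rewrite mulf_neq0 ?signr_eq0 ?expfz_neq0 ?q_neq0.
have q1 : 1 - q != 0.
  by rewrite subr_eq0 -tofrac1 tofrac_eq eq_sym -subr_eq0 -size_poly_eq0 size_XsubC.
rewrite !mxE !big_ord_recl !big_ord0 !mxE /= !mulr1 !addr0.
have -> : lift ord0 ord0 = 1 :> 'I_2 by exact: val_inj.
by rewrite moebius_scale.
Qed.

(* q^(deg f) f(1/q), written on coefficients; cf. recipE. *)
Definition recip (f : {poly int}) : {poly int} :=
  \sum_(i < size f) f`_i *: 'X^((size f).-1 - i).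

Lemma recipE (f : {poly int}) :
  (recip f)%:F = q ^+ (size f).-1 * (map_poly (intr : int -> Zq) f).[q^-1].
Proof.
rewrite (horner_coef_wide _ (size_poly _ _)) mulr_sumr /recip rmorph_sum.
apply: eq_bigr => i _ /=; rewrite coef_map /= -mul_polyC tofracM tofracXn -/q.
have -> : (f`_i)%:P = (f`_i)%:~R by rewrite -[in LHS](intz (f`_i)) rmorph_int.
rewrite [X in X * _ = _]rmorph_int exprVn mulrCA; congr (_ * _).
have le_i : (i <= (size f).-1)%N by case: (size f) i => [[]|n [j]] //=.
by rewrite -{2}(subnK le_i) exprD mulfK // expf_neq0 ?q_neq0.
Qed.

(* Main.v *)
Require Import Defs.
From mathcomp Require Import all_boot all_order all_algebra.
From mathcomp Require Import ring lra zify.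

Set Implicit Arguments.
Unset Strict Implicit.
Unset Printing Implicit Defensive.

Import Order.TTheory GRing.Theory Num.Theory.
Local Open Scope ring_scope.

(** The matrices [R_q] and [L_q] deform the two generators of [SL_2(Z)], and the
lower entry of [M_q (1, 1 - q)^T] depends, up to a factor [+-q^n], only on the
fraction whose deformation it is.  Working with words in the two letters
[R = (t 1; 0 1)] and [L = (t 0; t 1)] (the latter is [q L_q], so that everything
is polynomial in [t]), the vector [W(t) (1, 1 - t)^T] of a word [W] specializes
at [t = 1] to the first column [(r, s)] of an element of the free monoid on
[R] and [L].  The word can be read off [(r, s)] by the Euclidean algorithm,
except for trailing letters [R], which fix [(1, 1 - t)^T]; hence [(r, s)]
determines the vector (wordvec_inj).  Leading letters [R] do not change the lower entry and
add multiples of [s] to [r], so the [q]-denominator is a function of [s] and of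
the class of [r] modulo [s]: this is the relation [is_qdenom r s f].

Two symmetries of words then give the theorem.

Reversal: there is a symmetric matrix [X], with second column proportional to
[(1, 1 - t)^T], such that [R X] and [L X] are symmetric.  Therefore
[W^rev X = (W X)^T] (wordmx_rev).  The lower right entry is invariant under
transposition, so reversing a word preserves its [q]-denominator; at [t = 1]
it exchanges the diagonal entries of [(r b; s d)], and [r d - b s = 1] makes
[d] the inverse of [r] modulo [s].

Exchange of [R] and [L]: conjugation by [J = (0 1; 1 0)] turns
[t R(1/t)] into [L(t)] and [t L(1/t)] into [R(t)] (wordmx_flip).  Since
the letter [L] maps [(1, 1 - t)^T] to [(t, 1)^T], a word of the
form [L W L] has lower entry [(t, 1) W (t, 1)^T], and exchanging the letters of
[W] amounts to taking the reciprocal polynomial, while [(r, s)] becomes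
[(s - r, s)].  So the [q]-denominators of opposite residues are reciprocal to
each other (is_qdenom_opp).

Finally these polynomials are the normalized denominators of the left
[q]-rationals, also of the negative ones (is_qdenom_Sflat): a negative expansion
is a product of powers of [R_q^-1] and [L_q^-1], and conjugation by
[diag(-q, 1)] carries these to [R] and [L] at [1/q], up to scalars, so it
yields the reciprocal polynomial of a positive fraction.  The case
[r r' = 1] is the reversal symmetry, and [r r' = -1] is the same statement for
[r] and [- r']. *)

(** * Words in the two deformed generators *)

Section Words.
Variable A : comNzRingType.
Implicit Types (t : A) (w : seq bool).

(** These are convertible to [mx2] and [cv2] over [Zq]; an arbitrary ring is needed
to compare [t = q], [t = q^-1], [t = 'X] and [t = 1]. *)
Definition mat2 (a b c d : A) : 'M[A]_2 :=
  \matrix_(i, j) if i == 0 then (if j == 0 then a else b)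
                 else (if j == 0 then c else d).

Definition col2 (a b : A) : 'cV[A]_2 := \col_i if i == 0 then a else b.

Lemma mulmx2E n (M : 'M[A]_2) (N : 'M[A]_(2, n)) i j :
  (M *m N) i j = M i 0 * N 0 j + M i 1 * N 1 j.
Proof.
rewrite mxE !big_ord_recl big_ord0 addr0.
by have -> : lift ord0 ord0 = 1 :> 'I_2 by exact: val_inj.
Qed.

Lemma matrix2P n (M N : 'M[A]_(2, n)) :
  (forall j, M 0 j = N 0 j) -> (forall j, M 1 j = N 1 j) -> M = N.
Proof.
move=> H0 H1; apply/matrixP => -[[|[|//]] i] j.
  by rewrite (_ : Ordinal i = 0) ?H0 //; exact: val_inj.
by rewrite (_ : Ordinal i = 1) ?H1 //; exact: val_inj.
Qed.

Lemma square2P (M N : 'M[A]_2) :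
  M 0 0 = N 0 0 -> M 0 1 = N 0 1 -> M 1 0 = N 1 0 -> M 1 1 = N 1 1 -> M = N.
Proof.
move=> H00 H01 H10 H11.
have ord2 (P : 'I_2 -> Prop) : P 0 -> P 1 -> forall j, P j.
  by move=> P0 P1 [[|[|//]] i]; [rewrite (_ : Ordinal i = 0) |
    rewrite (_ : Ordinal i = 1)] => //; exact: val_inj.
by apply: matrix2P; apply: ord2.
Qed.

(** [true] stands for [R_t] and [false] for [t L_t]; the factor [t] clears the
denominator of [L_t]. *)
Definition letter t (b : bool) := if b then mat2 t 1 0 1 else mat2 t 0 t 1.

Definition wordmx t w : 'M[A]_2 := foldr (fun b M => letter t b *m M) 1%:M w.

Definition wordvec t w : 'cV[A]_2 := wordmx t w *m col2 1 (1 - t).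

Lemma wordmx_cat t w1 w2 : wordmx t (w1 ++ w2) = wordmx t w1 *m wordmx t w2.
Proof. by elim: w1 => [|b w1 IH] /=; rewrite ?mul1mx // IH mulmxA. Qed.

Lemma wordvec_cons t b w : wordvec t (b :: w) = letter t b *m wordvec t w.
Proof. by rewrite /wordvec /= mulmxA. Qed.

Lemma wordvec_nil t : (wordvec t [::] 0 0 = 1) * (wordvec t [::] 1 0 = 1 - t).
Proof. by rewrite /wordvec mul1mx !mxE. Qed.

Lemma wordvec_R t w :
  (wordvec t (true :: w) 0 0 = t * wordvec t w 0 0 + wordvec t w 1 0)
  * (wordvec t (true :: w) 1 0 = wordvec t w 1 0).
Proof. by rewrite wordvec_cons !mulmx2E !mxE /= mul0r !mul1r add0r. Qed.

Lemma wordvec_L t w :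
  (wordvec t (false :: w) 0 0 = t * wordvec t w 0 0)
  * (wordvec t (false :: w) 1 0 = t * wordvec t w 0 0 + wordvec t w 1 0).
Proof. by rewrite wordvec_cons !mulmx2E !mxE /= mul0r !mul1r addr0. Qed.

(** [R] fixes the seed vector [(1, 1 - t)^T], the deformation of the point at
infinity. *)
Lemma wordvec_rcons_R t w : wordvec t (rcons w true) = wordvec t w.
Proof.
rewrite /wordvec -cats1 wordmx_cat -mulmxA; congr (_ *m _).
by apply: matrix2P => j; rewrite /= mulmx1 mulmx2E !mxE /=; ring.
Qed.

(** Found by solving the linear conditions that the matrix itself and its products
with both letters are symmetric. *)
Definition symm t : 'M[A]_2 := mat2 (t - 1) t t (t * (1 - t)).

Lemma wordmx_rev t w : wordmx t (rev w) *m symm t = (wordmx t w *m symm t)^T.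
Proof.
have symT : (symm t)^T = symm t by apply: square2P; rewrite !mxE.
have letT b : letter t b *m symm t = symm t *m (letter t b)^T.
  by apply: square2P; rewrite !mulmx2E !mxE; case: b; rewrite !mxE /=; ring.
elim: w => [|b w IH]; first by rewrite /= !mul1mx symT.
rewrite rev_cons -cats1 wordmx_cat /= mulmx1 -mulmxA letT mulmxA IH.
by rewrite !trmx_mul symT mulmxA.
Qed.

(** The second column of [symm t] is [t (1, 1 - t)^T], so the lower entry of a
word vector is, up to the factor [t], a diagonal entry of [wordmx t w *m symm t].
The factor [t] stays because it need not be regular in [A]. *)
Lemma wordvec_rev t w : t * wordvec t (rev w) 1 0 = t * wordvec t w 1 0.
Proof.
have symE u : (wordmx t u *m symm t) 1 1 = t * wordvec t u 1 0.
  by rewrite /wordvec !mulmx2E !mxE /=; ring.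
by rewrite -!symE wordmx_rev mxE.
Qed.

End Words.

Lemma map_wordmx (A B : comNzRingType) (f : {rmorphism A -> B}) t w :
  map_mx f (wordmx t w) = wordmx (f t) w.
Proof.
elim: w => [|b w IH] /=; first by rewrite map_mx1.
rewrite map_mxM IH; congr (_ *m _); apply: square2P; case: b; rewrite !mxE /=;
  by rewrite ?rmorph0 ?rmorph1.
Qed.

Lemma map_wordvec (A B : comNzRingType) (f : {rmorphism A -> B}) t w i :
  f (wordvec t w i 0) = wordvec (f t) w i 0.
Proof.
rewrite /wordvec -map_wordmx !mulmx2E rmorphD !rmorphM !mxE /=.
by rewrite rmorphB rmorph1.
Qed.

(** * The fraction of a word

At [t = 1] the seed is [(1, 0)^T] and the vector of a word is the first
column of its matrix in [SL_2(Z)]. *)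

Definition numer w : int := wordvec (1 : int) w 0 0.
Definition denom w : int := wordvec (1 : int) w 1 0.

Lemma frac_nil : (numer [::] = 1) * (denom [::] = 0).
Proof. by rewrite /numer /denom !wordvec_nil subrr. Qed.

Lemma frac_R w :
  (numer (true :: w) = numer w + denom w) * (denom (true :: w) = denom w).
Proof. by rewrite /numer /denom !wordvec_R mul1r. Qed.

Lemma frac_L w :
  (numer (false :: w) = numer w) * (denom (false :: w) = numer w + denom w).
Proof. by rewrite /numer /denom !wordvec_L mul1r. Qed.

Lemma frac_ge w : 1 <= numer w /\ 0 <= denom w.
Proof.
elim: w => [|[] w [IH0 IH1]]; rewrite ?frac_nil ?frac_R ?frac_L //; lia.
Qed.

(** The first letter is [R] when the numerator exceeds the denominator and [L]
otherwise, so the fraction determines the word up to trailing letters [R];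
these fix the seed. *)
Lemma wordvec_inj (A : comNzRingType) (t : A) w w' :
  numer w = numer w' -> denom w = denom w' -> wordvec t w = wordvec t w'.
Proof.
have nil w1 : denom w1 = 0 -> wordvec t w1 = wordvec t [::].
  elim: w1 => [//|[] w1 IH]; rewrite ?frac_R ?frac_L => E; last first.
    by have := frac_ge w1; lia.
  rewrite wordvec_cons IH //; apply: matrix2P => j; rewrite /wordvec mul1mx;
    by rewrite mulmx2E !mxE /=; ring.
elim: w w' => [|b w IH] w'.
  by move=> _; rewrite frac_nil => E; rewrite [RHS]nil.
case: w' => [|b' w'].
  by move=> _; rewrite frac_nil => E; rewrite [LHS]nil.
have := frac_ge w; have := frac_ge w'.
by case: b; case: b'; rewrite ?frac_R ?frac_L => H H' E0 E1;
  first [by rewrite !wordvec_cons (IH w') //; lia | exfalso; lia].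
Qed.

Lemma det2E (A : comNzRingType) (M : 'M[A]_2) :
  \det M = M 0 0 * M 1 1 - M 0 1 * M 1 0.
Proof.
rewrite (expand_det_row _ 0) !big_ord_recl big_ord0 /cofactor !det_mx11 !mxE /=.
rewrite expr0 expr1 mul1r mulN1r mulrN addr0.
have l1 : lift ord0 ord0 = 1 :> 'I_2 by exact: val_inj.
have l2 : lift (1 : 'I_2) 0 = 0 :> 'I_2 by exact: val_inj.
by rewrite !l1 ?l2.
Qed.

Lemma det_wordmx1 w : \det (wordmx (1 : int) w) = 1.
Proof.
elim: w => [|b w IH] /=; first by rewrite det1.
by rewrite det_mulmx IH; case: b; rewrite det2E !mxE.
Qed.

Lemma fracE w : (numer w = wordmx (1 : int) w 0 0)
  * (denom w = wordmx (1 : int) w 1 0).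
Proof.
have E i : wordvec (1 : int) w i 0 = wordmx 1 w i 0.
  by rewrite /wordvec mulmx2E !mxE /= subrr mulr0 mulr1 addr0.
by rewrite /numer /denom !E.
Qed.

(** At [t = 1] transposition along the antidiagonal exchanges the diagonal
entries of the matrix of [w], whose determinant is 1. *)
Lemma frac_rev w : denom (rev w) = denom w
  /\ exists k, numer w * numer (rev w) = 1 + k * denom w.
Proof.
split; first by have := wordvec_rev (1 : int) w; rewrite !mul1r.
rewrite !fracE; have := det_wordmx1 w; rewrite det2E.
have /matrixP/(_ 0 1) := wordmx_rev (1 : int) w.
rewrite [RHS]mxE !mulmx2E !mxE /= !subrr !mulr0 !mulr1 !addr0 ?add0r => -> D.
by exists (wordmx (1 : int) w 0 1); rewrite -[X in _ = X + _]D subrK.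
Qed.

Lemma frac_coprime w : coprimez (numer w) (denom w).
Proof.
apply/coprimezP; exists (wordmx (1 : int) w 1 1, - wordmx (1 : int) w 0 1) => /=.
by rewrite !fracE mulNr [X in X - _]mulrC -det2E det_wordmx1.
Qed.

(** * Exchanging the two letters *)

Definition flip : seq bool -> seq bool := map negb.

(** Each letter satisfies [t R(1/t) J = J L(t)] and [t L(1/t) J = J R(t)].  The
inverse of [t] is a parameter [u], so that the lemma serves both the fraction
field and the integers at [t = 1]. *)
Lemma wordmx_flip (A : comNzRingType) (t u : A) w : t * u = 1 ->
  t ^+ size w *: wordmx u w *m mat2 0 1 1 0
    = mat2 0 1 1 0 *m wordmx t (flip w).
Proof.
move=> tu.
have letterJ b : t *: letter u b *m mat2 0 1 1 0
                 = mat2 0 1 1 0 *m letter t (~~ b).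
  apply: square2P; rewrite !mulmx2E; case: b; rewrite !mxE /=;
  by rewrite ?(mul0r, mulr0, mul1r, mulr1, addr0, add0r, tu).
elim: w => [|b w IH] /=; first by rewrite scale1r mulmx1 mul1mx.
rewrite mulmxA -letterJ -[RHS]mulmxA -IH exprS -scalerA -!scalemxAl -scalemxAr.
by rewrite !mulmxA.
Qed.

Lemma wordmx_flipE (A : comNzRingType) (t u : A) w (W := wordmx u w)
    (W' := wordmx t (flip w)) : t * u = 1 ->
  [/\ W' 0 0 = t ^+ size w * W 1 1, W' 0 1 = t ^+ size w * W 1 0,
      W' 1 0 = t ^+ size w * W 0 1 & W' 1 1 = t ^+ size w * W 0 0].
Proof.
move=> tu; have /matrixP E := wordmx_flip w tu.
have {}E i j : t ^+ size w * (W *m mat2 0 1 1 0) i j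
             = (mat2 0 1 1 0 *m W') i j by rewrite -E -scalemxAl [RHS]mxE.
move: (E 0 0) (E 0 1) (E 1 0) (E 1 1); rewrite !mulmx2E !mxE /=.
by rewrite !(mul0r, mulr0, mul1r, mulr1, addr0, add0r).
Qed.

(** The bottom row of [L] is [(t, 1)] and [L] maps the seed to [(t, 1)^T]. *)
Lemma wordvec_LL (A : comNzRingType) (t : A) w (W := wordmx t w) :
  (wordvec t (false :: rcons w false) 0 0 = t * (t * W 0 0 + W 0 1))
  * (wordvec t (false :: rcons w false) 1 0
     = t * (t * W 0 0 + W 0 1) + (t * W 1 0 + W 1 1)).
Proof.
rewrite !wordvec_L.
have E i : wordvec t (rcons w false) i 0 = t * W i 0 + W i 1.
  rewrite /wordvec -cats1 wordmx_cat -mulmxA mulmx2E /= mulmx1 !mulmx2E !mxE /= -/W.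
  by ring.
by rewrite !E.
Qed.

(** [(t, 1)] and [t (u, 1) = (1, t)] are exchanged by [J], which accounts for two
of the powers of [t]; the others come from the letters of [w]. *)
Lemma wordvec_flip (A : comNzRingType) (t u : A) w : t * u = 1 ->
  wordvec t (false :: rcons (flip w) false) 1 0
    = t ^+ (size w).+2 * wordvec u (false :: rcons w false) 1 0.
Proof.
move=> tu; rewrite !wordvec_LL; have [-> -> -> ->] := wordmx_flipE w tu.
rewrite !exprS; set T := t ^+ size w.
transitivity (T * ((t * u) * (t * u) * wordmx u w 0 0
                   + (t * u) * t * wordmx u w 0 1
                   + (t * u) * t * wordmx u w 1 0
                   + t * t * wordmx u w 1 1)); last by ring.
by rewrite tu; ring.
Qed.

(** * Denominator polynomials *)

Definition qdenom w : {poly int} := wordvec 'X w 1 0.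

Lemma qdenom0 w : (qdenom w).[0] = 1.
Proof.
rewrite -[LHS]/(horner_eval 0 (wordvec 'X w 1 0)) map_wordvec /=.
rewrite /horner_eval hornerX.
elim: w => [|[] w IH]; rewrite ?wordvec_nil ?wordvec_R ?wordvec_L ?IH ?subr0 //.
by rewrite mul0r add0r.
Qed.

Lemma qdenom_tofrac w : FracField.tofrac (qdenom w) = wordvec q w 1 0.
Proof. exact: map_wordvec. Qed.

Lemma qdenom_inv w :
  (map_poly (intr : int -> Zq) (qdenom w)).[q^-1] = wordvec q^-1 w 1 0.
Proof.
rewrite -[LHS]/((horner_eval q^-1 \o map_poly (intr : int -> Zq))
                  (wordvec 'X w 1 0)).
by rewrite map_wordvec /= map_polyX /horner_eval hornerX.
Qed.

(** A polynomial with nonzero constant term is determined by its class modulo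
powers of [q]. *)
Lemma tofrac_shift (f g : {poly int}) (k : int) : f.[0] != 0 -> g.[0] != 0 ->
  FracField.tofrac f = q ^ k * FracField.tofrac g -> f = g.
Proof.
have nat_shift (f1 g1 : {poly int}) (n : nat) : f1.[0] != 0 ->
    FracField.tofrac f1 = q ^+ n * FracField.tofrac g1 -> f1 = g1.
  move=> f0; rewrite /q -tofracXn -tofracM => /eqP; rewrite tofrac_eq => /eqP E.
  move: f0; rewrite E; case: n {E} => [|n]; first by rewrite mul1r.
  by rewrite !hornerE expr0n mul0r eqxx.
case: k => n f0 g0 E; first exact: (nat_shift _ _ n).
symmetry; apply: (nat_shift _ _ n.+1) => //.
by rewrite E NegzE -invr_expz -exprnP mulVKf // expf_neq0 // q_neq0.
Qed.

Lemma recip0 (f : {poly int}) : f != 0 -> (recip f).[0] != 0.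
Proof.
rewrite -lead_coef_eq0 /recip /lead_coef horner_sum.
case Ef: (size f) => [|n] /=; first by rewrite nth_default ?Ef ?eqxx.
rewrite big_ord_recr /= subnn big1 ?add0r => [|i _].
  by rewrite !hornerE.
by rewrite !hornerE expr0n subn_eq0 leqNgt ltn_ord mulr0.
Qed.

(** Both sides have nonzero constant term and agree, up to a power of [q], with
the left-hand polynomial evaluated at [1/q]. *)
Lemma recip_qdenom_flip w :
  recip (qdenom (false :: rcons w false)) = qdenom (false :: rcons (flip w) false).
Proof.
set f := qdenom _; set g := qdenom _.
have f0 : f != 0.
  apply/eqP => f0; have := qdenom0 (false :: rcons w false).
  by rewrite -/f f0 horner0 => /eqP; rewrite eq_sym oner_eq0.
apply: (@tofrac_shift _ _ ((size f).-1%:Z - (size w).+2%:Z));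
  rewrite ?recip0 ?qdenom0 //.
rewrite recipE qdenom_inv qdenom_tofrac (wordvec_flip _ (mulfV q_neq0)).
rewrite expfzDr ?q_neq0 // -invr_expz -!exprnP mulrA -mulrA.
by rewrite mulrA mulfVK ?expf_neq0 ?q_neq0.
Qed.

(** * Denominator polynomials of residue classes *)

Definition is_qdenom (r s : int) (f : {poly int}) := exists w,
  [/\ denom w = s, (numer w = r %[mod s])%Z & qdenom w = f].

Lemma wordvec_nseqR (A : comNzRingType) (t : A) n w :
  wordvec t (nseq n true ++ w) 1 0 = wordvec t w 1 0.
Proof. by elim: n => //= n IH; rewrite wordvec_R. Qed.

Lemma frac_nseqR n w :
  (numer (nseq n true ++ w) = numer w + n%:Z * denom w)
  * (denom (nseq n true ++ w) = denom w).
Proof.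
elim: n => [|n IH] /=; first by rewrite mul0r addr0.
by rewrite !frac_R !IH; split=> //; lia.
Qed.

Lemma frac_nseqL n w :
  (numer (nseq n false ++ w) = numer w)
  * (denom (nseq n false ++ w) = n%:Z * numer w + denom w).
Proof.
elim: n => [|n IH] /=; first by rewrite mul0r add0r.
by rewrite !frac_L !IH; split=> //; lia.
Qed.

(** Two words with numerators congruent modulo the denominator get the same
fraction after leading letters [R] are added to one of them. *)
Lemma is_qdenom_inj r s f g : 0 < s -> is_qdenom r s f -> is_qdenom r s g -> f = g.
Proof.
move=> s0 [w [ws wr <-]] [w' [ws' wr' <-]].
have /dvdzP[k Ek] : (s %| numer w' - numer w)%Z.
  by rewrite -eqz_mod_dvd wr wr'.
wlog k0 : w w' k ws wr ws' wr' Ek / 0 <= k.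
  move=> H; case: (lerP 0 k) => [|k0]; first exact: (H w w' k).
  by symmetry; apply: (H w' w (- k)); rewrite // ?mulNr -?Ek ?opprB //; lia.
rewrite /qdenom -(wordvec_nseqR _ `|k| w).
rewrite (@wordvec_inj _ 'X (nseq `|k| true ++ w) w') //.
  by rewrite frac_nseqR ws gez0_abs // -Ek addrC subrK.
by rewrite frac_nseqR ws ws'.
Qed.

Lemma is_qdenom_mod r r' s f : (r = r' %[mod s])%Z ->
  is_qdenom r s f -> is_qdenom r' s f.
Proof. by move=> E [w [ws wr df]]; exists w; rewrite wr E. Qed.

(** The word of an inverse residue is the reversed word. *)
Lemma is_qdenom_inv r s f :
  is_qdenom r s f -> exists2 r', (r * r' = 1 %[mod s])%Z & is_qdenom r' s f.
Proof.
move=> [w [ws wr df]]; have [ws' [k E]] := frac_rev w.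
exists (numer (rev w)).
  by rewrite -modzMml -wr modzMml E ws addrC modzMDl.
exists (rev w); split; rewrite ?ws' //; rewrite -df.
by apply: (@mulfI _ 'X); rewrite ?polyX_eq0 ?wordvec_rev.
Qed.

(** Leading and trailing letters [R] are irrelevant for the denominator of a
residue class, and what remains has the shape to which wordvec_flip applies. *)
Lemma strip_R w : 0 < denom w -> exists w',
  [/\ w' = [:: false] \/ exists u, w' = false :: rcons u false,
      denom w' = denom w,
      (numer w' = numer w %[mod denom w])%Z
    & qdenom w' = qdenom w].
Proof.
have [n] := ubnP (size w); elim: n w => // n IH [|[] w] /= sw.
- by rewrite frac_nil.
- rewrite frac_R => s0; have [w' [H E1 E2 E3]] := IH w sw s0.
  exists w'; split => //; last by rewrite E3 /qdenom wordvec_R.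
  by rewrite frac_R E2 modzDr.
case/lastP: w sw => [|w []] sw s0.
- by exists [:: false]; split=> //; left.
- have E (A : comNzRingType) (t : A) :
      wordvec t (false :: rcons w true) = wordvec t (false :: w).
    by rewrite -rcons_cons wordvec_rcons_R.
  rewrite /qdenom /numer /denom !E in s0 *.
  by apply: IH s0; move: sw; rewrite size_rcons /=; lia.
- by exists (false :: rcons w false); split=> //; right; exists w.
Qed.

(** For a word [L u L] with fraction [(r, s)], exchanging the letters of [u] leads
to [(s - r, s)] and to the reciprocal polynomial.  The word [L] has [s = 1],
where all residues agree. *)
Lemma is_qdenom_opp r s f : 0 < s -> is_qdenom r s f -> is_qdenom (- r) s (recip f).
Proof.
move=> s0 [w [ws wr <-]]; rewrite -ws in s0 wr *; rewrite {s ws}.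
have [w' [H E1 E2 <-]] := strip_R s0.
rewrite -E1 in s0 wr E2 *; rewrite -{}E2 {E1 w} in wr.
case: H => [Ew|[u Ew]]; rewrite {}Ew {w'} in s0 wr *.
  have d1 : qdenom [:: false] = 1 by rewrite /qdenom wordvec_L !wordvec_nil; ring.
  exists [:: false]; rewrite d1; split=> //.
    have -> : denom [:: false] = 1 by rewrite frac_L !frac_nil addr0.
    by rewrite !modz1.
  apply: (@tofrac_shift _ _ 0); rewrite ?recip0 ?oner_neq0 ?hornerE ?oner_neq0 //.
  by rewrite recipE size_poly1 !rmorph1 hornerC !expr0 mulr1.
exists (false :: rcons (flip u) false); rewrite recip_qdenom_flip; split=> //.
  by rewrite /denom (wordvec_flip _ (mulr1 1)) expr1n mul1r.
have -> : numer (false :: rcons (flip u) false)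
    = - numer (false :: rcons u false) + denom (false :: rcons u false).
  rewrite /numer /denom !wordvec_LL.
  have [-> -> _ _] := wordmx_flipE u (mulr1 (1 : int)).
  by rewrite expr1n; ring.
by rewrite modzDr -[LHS]modzNm wr modzNm.
Qed.

(** * Continued fractions as words

The word of an expansion uses absolute values, so that an expansion and its
opposite share their word; the common sign is handled separately. *)

Fixpoint cfword (a : seq int) : seq bool :=
  if a is b :: c :: t then nseq `|b| true ++ nseq `|c| false ++ cfword t else [::].

(** The vanishing of later entries is excluded because [[b, 0]] has value [b]
under the convention [0^-1 = 0], while the fraction of its word is infinite. *)
Lemma cfval_cfword (e : int) a : e = 1 \/ e = -1 -> ~~ odd (size a) ->
  all (fun b => b == e * `|b|%N%:Z) a -> all (fun b => b != 0) (behead a) ->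
  cfval a = e%:~R * ((numer (cfword a))%:~R / (denom (cfword a))%:~R).
Proof.
move=> e1; have ee : e%:~R * e%:~R = 1 :> rat.
  by case: e1 => ->; rewrite -?intrM.
have ie : (e%:~R)^-1 = e%:~R :> rat.
  by case: e1 => ->.
have [n] := ubnP (size a); elim: n a => // n IH [|b [|c t]] //= sz.
  by rewrite !frac_nil invr0 !mulr0.
rewrite negbK => ev /and3P[/eqP Eb /eqP Ec at_] /andP[c0 t0].
rewrite IH //; first last.
- by case: t t0 {sz ev at_} => //= d t /andP[].
- by move: sz; rewrite !ltnS; apply: leq_trans.
have := frac_ge (cfword t).
rewrite !frac_nseqR !frac_nseqL.
set p := numer _; set s := denom _ => -[p1 s0].
have p0 : p%:~R != 0 :> rat by rewrite intr_eq0; lia.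
have d0 : `|c|%N%:R * p%:~R + s%:~R != 0 :> rat.
  by rewrite -[`|c|%N%:R]/(`|c|%N%:Z%:~R) -intrM -intrD intr_eq0; nia.
rewrite {1}Eb {1}Ec !invfM invrK ie.
have -> : (e * `|c|%N%:Z)%:~R + e%:~R * (p%:~R^-1 * s%:~R)
        = e%:~R * ((`|c|%N%:R * p%:~R + s%:~R) / p%:~R) :> rat.
  by rewrite rmorphM /=; field.
rewrite !invfM ie invrK !rmorphD !rmorphM /= rmorphD rmorphM /=; field.
by rewrite d0.
Qed.

Lemma wordmx_nseq (A : comNzRingType) (Y M : 'M[A]_2) (t c : A) b n :
  Y *m M = c *: (letter t b *m Y) ->
  Y *m (M ^+ n) = c ^+ n *: (wordmx t (nseq n b) *m Y).
Proof.
move=> E; elim: n => [|n IH]; first by rewrite !expr0 scale1r mulmx1 mul1mx.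
rewrite !exprS mulmxA E /= -!scalemxAl -!mulmxA IH -!scalemxAr scalerA.
by rewrite !mulmxA.
Qed.

Lemma exprz_abs (U : unitRingType) (x : U) (e b : int) :
  b = e * `|b|%N%:Z -> x ^ b = (x ^ e) ^+ `|b|.
Proof. by move=> E; rewrite {1}E -exprz_exp exprnP. Qed.

Lemma intertwine3 (A : comNzRingType) (Y P Q N P' Q' N' : 'M[A]_2) (c d : A) :
  Y *m P = P' *m Y -> Y *m Q = c *: (Q' *m Y) -> Y *m N = d *: (N' *m Y) ->
  Y *m (P * Q * N) = (c * d) *: (P' *m (Q' *m N') *m Y).
Proof.
move=> EP EQ EN; rewrite -[P * Q * N]/(P *m Q *m N) !mulmxA EP.
rewrite -[P' *m Y *m Q]mulmxA EQ -scalemxAr -scalemxAl.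
rewrite -!mulmxA EN -!scalemxAr scalerA; by [].
Qed.

(** Stated for an intertwiner [Y], so that it covers both signs: [e = 1] with [Y]
the identity and [t = q], and [e = -1] with [Y = diag(-q, 1)] and
[t = q^-1]. *)
Lemma Mq_cfword (e : int) (Y : 'M[Zq]_2) (t c : Zq) a :
  Y *m Rq ^ e = letter t true *m Y ->
  Y *m Lq ^ e = c *: (letter t false *m Y) ->
  ~~ odd (size a) -> all (fun b => b == e * `|b|%N%:Z) a ->
  exists n : nat, Y *m Mq a = c ^+ n *: (wordmx t (cfword a) *m Y).
Proof.
move=> ER EL; have [n] := ubnP (size a); elim: n a => // n IH [|b [|c' u]] //= sz.
  by move=> _ _; exists 0%N; rewrite mulmx1 mul1mx scale1r.
rewrite negbK => ev /and3P[/eqP Eb /eqP Ec au].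
have [|k Ek] := IH u _ ev au; first by move: sz; rewrite !ltnS; apply: leq_trans.
exists (`|c'| + k)%N; rewrite !wordmx_cat exprD.
rewrite (exprz_abs _ Eb) (exprz_abs _ Ec).
apply: intertwine3 => //; last exact: wordmx_nseq.
have := @wordmx_nseq _ Y (Rq ^ e) t 1 true `|b|.
by rewrite expr1n !scale1r; apply.
Qed.

(** * Normalized denominators of left q-rationals *)

(** The normalization [S(0) = 1] absorbs any sign and any power of [q]. *)
Lemma Sflat_eq x (b : bool) (k : int) (f : {poly int}) : f.[0] = 1 ->
  left_vec x 1 0 = (-1) ^+ b * q ^ k * FracField.tofrac f -> Sflat x = f.
Proof.
move=> f0 E; have /andP[/eqP EN /eqP N0] := left_normP x.
rewrite /Sflat; move: EN N0; case: (left_norm x) => -[b' k'] S /=.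
rewrite E => EN S0.
have {}EN : FracField.tofrac S
          = q ^ (k' + k) * FracField.tofrac ((-1) ^+ (b' + b) * f).
  rewrite -EN tofracM expfzDr ?q_neq0 // exprD rmorphM !rmorphXn /= rmorphN1.
  by ring.
have [n0 | n0] : (-1) ^+ (b' + b) = 1 :> {poly int}
              \/ (-1) ^+ (b' + b) = -1 :> {poly int}.
- by rewrite -signr_odd; case: odd; [right | left].
- by rewrite n0 mul1r in EN; apply: tofrac_shift EN; rewrite ?S0 ?f0 oner_neq0.
have ES : S = - f.
  rewrite n0 mulN1r in EN; apply: tofrac_shift EN;
    by rewrite ?hornerN ?S0 ?f0 ?oppr_eq0 oner_neq0.
by move: S0; rewrite ES hornerN f0.
Qed.

(** The identities behind the conjugation by [diag(-q, 1)], over an abstract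
field, where [field] does not compute with fractions of polynomials. *)
Section Conjugation.
Variables (K : fieldType) (z : K).
Hypothesis z0 : z != 0.
Let Y := mat2 (- z) 0 0 1.

Lemma conj_invR : Y = 1 *: (letter z^-1 true *m Y *m mat2 z 1 0 1).
Proof.
by rewrite scale1r; apply: square2P; rewrite !mulmx2E !mxE /=; field.
Qed.

Lemma conj_invL : Y = z *: (letter z^-1 false *m Y *m mat2 1 0 1 z^-1).
Proof.
by apply: square2P; rewrite [RHS]mxE !mulmx2E !mxE /=; field.
Qed.

Lemma conj_inv_seed : Y *m col2 1 (1 - z) = - z *: col2 1 (1 - z^-1).
Proof. by apply: matrix2P => j; rewrite [RHS]mxE mulmx2E !mxE /=; field. Qed.

Lemma scale_letterL : mat2 1 0 1 z^-1 = z^-1 *: letter z false.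
Proof. by apply: square2P; rewrite !mxE /=; field. Qed.

Lemma bottom_Lseed : (mat2 1 0 1 z^-1 *m col2 1 (1 - z)) 1 0
  = (-1) ^+ false * z ^ (-1) * wordvec z [:: false] 1 0.
Proof.
rewrite wordvec_L !wordvec_nil exprN1 expr0 mulmx2E !mxE /=; by field.
Qed.

Lemma collect_scale (y x : K) n k : y = z ^+ k * x ->
  z ^+ n * (- z * x) = - 1 * (z ^ (n%:Z + 1 - k%:Z)) * y :> K.
Proof.
move=> ->; rewrite !expfzDr // -invr_expz -!exprnP expr1.
by field; rewrite expf_neq0.
Qed.

End Conjugation.

Lemma Sflat_cfword_pos x : ~~ odd (size (even_cf x)) ->
  all (fun b => b == 1 * `|b|%N%:Z) (even_cf x) ->
  Sflat x = qdenom (cfword (even_cf x)).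
Proof.
move=> od al.
have [||n En] := @Mq_cfword 1 1%:M q q^-1 _ _ _ od al.
- by rewrite expr1z mul1mx mulmx1.
- rewrite expr1z mul1mx mulmx1; exact: scale_letterL q_neq0.
apply: (@Sflat_eq _ false (- n%:Z)); first exact: qdenom0.
rewrite mul1mx mulmx1 in En.
rewrite /left_vec En -scalemxAl mxE qdenom_tofrac mul1r /wordvec.
by rewrite exprVn -invr_expz -exprnP.
Qed.

Lemma Sflat_cfword_neg x : ~~ odd (size (even_cf x)) ->
  all (fun b => b == -1 * `|b|%N%:Z) (even_cf x) ->
  (recip (qdenom (cfword (even_cf x)))).[0] = 1 ->
  Sflat x = recip (qdenom (cfword (even_cf x))).
Proof.
move=> od al r0.
set Y := mat2 (- q) 0 0 1 : 'M[Zq]_2.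
have YE n (M : 'M[Zq]_(2, n)) j : (Y *m M) 1 j = M 1 j.
  by rewrite mulmx2E !mxE /= mul0r mul1r add0r.
have inv M N c : M \is a GRing.unit -> Y = c *: (N *m Y *m M) ->
    Y *m M ^ (-1) = c *: (N *m Y).
  move=> uM E; rewrite exprN1 {1}E -scalemxAl -[_ *m M *m _]mulmxA.
  by rewrite (mulrV uM : M *m M^-1 = 1%:M) mulmx1.
have [||n En] := @Mq_cfword (-1) Y q^-1 q _ _ _ od al.
- by rewrite -[RHS]scale1r; apply: (inv _ _ _ Rq_unit); exact: (conj_invR q_neq0).
- by apply: (inv _ _ _ Lq_unit); exact: (conj_invL q_neq0).
set w := cfword _ in r0 En *.
apply: (@Sflat_eq _ true (n%:Z + 1 - (size (qdenom w)).-1%:Z)); first exact: r0.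
rewrite -YE /left_vec mulmxA En -scalemxAl -mulmxA.
rewrite (conj_inv_seed q_neq0 : Y *m cv2 1 (1 - q) = _) -scalemxAr.
rewrite [LHS]mxE [X in _ * X]mxE -/(wordvec _ _) expr1.
apply: collect_scale; first exact: q_neq0.
by rewrite recipE qdenom_inv.
Qed.

(** Both fractions are in lowest terms; the left one has a positive denominator
since its value is not [0]. *)
Lemma frac_inj w (n s : int) : 0 < n -> 0 < s -> coprimez n s ->
  (numer w)%:~R / (denom w)%:~R = n%:~R / s%:~R :> rat ->
  numer w = n /\ denom w = s.
Proof.
move=> n0 s0 co E; have [p1 d0] := frac_ge w.
have dn0 : denom w != 0.
  apply/eqP => d; move/eqP: E; rewrite d invr0 mulr0 eq_sym.
  rewrite mulf_eq0 invr_eq0 !intr_eq0.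
  by lia.
have cw : coprime `|numer w| `|denom w| := frac_coprime w.
have cn : coprime `|n| `|s| := co.
have := congr1 numq E; rewrite (coprimeq_num cw) (coprimeq_num cn).
have := congr1 denq E; rewrite (coprimeq_den cw) (coprimeq_den cn).
rewrite (negPf dn0) (gt_eqF s0) (gtr0_norm s0) (ger0_norm d0) => Ed.
by rewrite !gtr0_sg ?mul1r => [-> //||]; lia.
Qed.

Lemma is_qdenom0 r s f : is_qdenom r s f -> f.[0] = 1.
Proof. by move=> [w [_ _ <-]]; exact: qdenom0. Qed.

(** The denominator of [r/s] belongs to the class of [r]: for positive [r] by the
word of the expansion, for negative [r] through the reciprocal polynomial of
[- r], and for [r = 0] by computation from the conventional expansion
[[-1, 1]]. *)
Lemma is_qdenom_Sflat r s : 0 < s -> coprimez r s ->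
  is_qdenom r s (Sflat (r%:~R / s%:~R)).
Proof.
move=> s0 co; have sQ : 0 < s%:~R :> rat by rewrite ltr0z.
have := even_cfP (r%:~R / s%:~R); rewrite /is_even_cf.
rewrite mulf_eq0 invr_eq0 (gt_eqF sQ) orbF intr_eq0 pmulr_lgt0 ?invr_gt0 // ltr0z.
move=> /and3P[od /eqP va]; case: (ltgtP r 0) => [r0|r0|r0].
- case/andP=> h t.
  have al : all (fun b => b == -1 * `|b|%N%:Z) (even_cf (r%:~R / s%:~R)).
    case: even_cf h t {od va} => //= b u b0 u1; apply/andP; split; first by lia.
    by apply: sub_all u1 => c /=; lia.
  have nz : all (fun b => b != 0) (behead (even_cf (r%:~R / s%:~R))).
    by apply: sub_all t => c; lia.
  have := cfval_cfword (or_intror erefl) od al nz; rewrite va => E.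
  have [||||Ep Es] := @frac_inj (cfword (even_cf (r%:~R / s%:~R))) (- r) s.
  + lia.
  + done.
  + by rewrite /coprimez gcdNz.
  + by rewrite rmorphN mulNr [X in _ = - X]E mulN1r opprK.
  have D : is_qdenom r s (recip (qdenom (cfword (even_cf (r%:~R / s%:~R))))).
    have D : is_qdenom (- r) s (qdenom (cfword (even_cf (r%:~R / s%:~R)))).
      by exists (cfword (even_cf (r%:~R / s%:~R))); rewrite Ep Es.
    by have := is_qdenom_opp s0 D; rewrite opprK.
  by rewrite Sflat_cfword_neg // (is_qdenom0 D).
- case/andP=> h t.
  have al : all (fun b => b == 1 * `|b|%N%:Z) (even_cf (r%:~R / s%:~R)).
    case: even_cf h t {od va} => //= b u b0 u1; apply/andP; split; first by lia.
    by apply: sub_all u1 => c /=; lia.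
  have nz : all (fun b => b != 0) (behead (even_cf (r%:~R / s%:~R))).
    by apply: sub_all t => c; lia.
  have := cfval_cfword (or_introl erefl) od al nz; rewrite va mul1r => E.
  have [||||Ep Es] := @frac_inj (cfword (even_cf (r%:~R / s%:~R))) r s => //.
  rewrite Sflat_cfword_pos //; exists (cfword (even_cf (r%:~R / s%:~R))).
  by rewrite Ep Es.
move=> /eqP ecf; have s1 : s = 1.
  by move: co; rewrite r0 /coprimez gcd0z => /eqP; lia.
rewrite {}r0 {}s1 in ecf sQ *.
exists [:: false]; split; rewrite ?modz1 // ?frac_L ?frac_nil //.
symmetry; apply: (@Sflat_eq _ false (-1)); first exact: qdenom0.
rewrite /left_vec ecf /= mulr1.
(* [R_q] leaves lower entries unchanged, so it can cancel [R_q^-1]. *)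
have Rrow n (M : 'M[Zq]_(2, n)) j : (Rq *m M) 1 j = M 1 j.
  by rewrite mulmx2E !mxE /= mul0r mul1r add0r.
rewrite -Rrow mulmxA -[Rq ^ (-1) * _]/(Rq ^ (-1) *m _) !mulmxA exprN1.
rewrite (mulrV Rq_unit : Rq *m Rq^-1 = 1%:M) mul1mx expr1z qdenom_tofrac.
exact: bottom_Lseed q_neq0.
Qed.

Theorem theorem1p1 (r r' s : int) (hs : 0 < s)
    (hr : coprimez r s) (hr' : coprimez r' s) :
  ((r * r' = 1 %[mod s])%Z ->
     Sflat (r%:~R / s%:~R) = Sflat (r'%:~R / s%:~R)) /\
  ((r * r' = -1 %[mod s])%Z ->
     Sflat (r%:~R / s%:~R) = recip (Sflat (r'%:~R / s%:~R))).
Proof.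
have key r1 f : (r * r1 = 1 %[mod s])%Z -> is_qdenom r1 s f ->
    Sflat (r%:~R / s%:~R) = f.
  move=> E D1; have [r2 E2 D2] := is_qdenom_inv (is_qdenom_Sflat hs hr).
  apply: is_qdenom_inj hs D2 _; apply: is_qdenom_mod D1.
  by rewrite -[r1]mulr1 -modzMmr -E2 modzMmr mulrCA mulrA -modzMml E modzMml mul1r.
have D' := is_qdenom_Sflat hs hr'; split=> E; first exact: key E D'.
apply: key (is_qdenom_opp hs D').
by rewrite mulrN -modzNm E modzNm opprK.
Qed.
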